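(* Assume that $D=\mathrm{diag}(d_1,\dots,d_n)\in\mathrm{GL}(n,F)$, where the family $\{d_1,\dots,d_n\}$ is norm closed and satisfies property (Q): every norm closed subfamily of $\{d_1,\dots,d_n\}$ is quaternionically nested. Then there exists a matrix $X\in\mathrm{GL}(n,K)$ satisfying $X^*X=D$.
   Context: $F$ is a field of characteristic zero, $d\in F^*\setminus {F^*}^2$, $K=F(\sqrt d)$, $n$ a positive integer. The nontrivial element of $\mathrm{Gal}(K/F)$ is $z\mapsto\overline z$, applied entrywise to matrices; $X^*=\overline X^T$, and $N(z)=\overline z z$ is the norm $K\to F$. Let $\Delta=\{d_1,\dots,d_m\}$ be a finite family of elements of $F^*$ (indexed, repetitions allowed). $\Delta$ is norm closed if $\prod_{i=1}^m d_i\in N(K)$. $\Delta$ is quaternionically nested if there is a permutation $\sigma\in S_m$ such that for each $i\in\{1,\dots,m\}$ the element $d_{\sigma(i)}$ is the norm of some element of the quaternion algebra $\big(d,\,-\prod_{k=1}^{i-1}d_{\sigma(k)}\big)_F$; equivalently, for each $i$ there exist $x,y\in K$ with $N(x)+N(y)\prod_{k=1}^{i-1}d_{\sigma(k)}=d_{\sigma(i)}$ (empty products are $1$). Here $(a,b)_F$ has basis $1,i,j,ij$ with $i^2=a$, $j^2=b$, $ji=-ij$, and its norm form is $(x^2-ay^2)-b(z^2-aw^2)$ at $x1+yi+zj+wij$. *)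

(* Defs.v *)
From HB Require Import structures.
From mathcomp Require Import all_boot all_order all_fingroup all_algebra all_field.
From mathcomp Require Import ring.

Set Implicit Arguments.
Unset Strict Implicit.
Unset Printing Implicit Defensive.

Import GRing.Theory.
Local Open Scope ring_scope.

(* The quaternion algebra (a, b)_F: [Quat x y z w] is x 1 + y i + z j + w ij. *)
Record quat (F : fieldType) (a b : F) :=
  Quat { qre : F; qi : F; qj : F; qij : F }.
Arguments Quat {F a b}.

Section QuaternionAlgebra.
Variables (F : fieldType) (a b : F).
Local Notation H := (quat a b).
Implicit Types p q r : H.

Definition quat_to_prod q := (qre q, qi q, qj q, qij q).
Definition quat_of_prod (t : F * F * F * F) : H :=
  let: (x, y, z, w) := t in Quat x y z w.
Lemma quat_to_prodK : cancel quat_to_prod quat_of_prod. Proof. by case. Qed.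
HB.instance Definition _ := Choice.copy H (can_type quat_to_prodK).

Definition quat_add p q : H :=
  Quat (qre p + qre q) (qi p + qi q) (qj p + qj q) (qij p + qij q).
Definition quat_opp q : H := Quat (- qre q) (- qi q) (- qj q) (- qij q).

Lemma quat_addA : associative quat_add.
Proof. by move=> p q r; congr Quat => /=; ring. Qed.
Lemma quat_addC : commutative quat_add.
Proof. by move=> p q; congr Quat => /=; ring. Qed.
Lemma quat_add0 : left_id (Quat 0 0 0 0) quat_add.
Proof. by case=> x y z w; congr Quat => /=; ring. Qed.
Lemma quat_addN : left_inverse (Quat 0 0 0 0) quat_opp quat_add.
Proof. by case=> x y z w; congr Quat => /=; ring. Qed.
HB.instance Definition _ :=
  GRing.isZmodule.Build H quat_addA quat_addC quat_add0 quat_addN.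

(* Bilinear extension of i * i = a, j * j = b, j * i = - (i * j). *)
Definition quat_mul p q : H :=
  let: Quat x y z w := p in let: Quat x' y' z' w' := q in
  Quat (x * x' + a * (y * y') + b * (z * z') - a * b * (w * w'))
       (x * y' + y * x' - b * (z * w') + b * (w * z'))
       (x * z' + z * x' + a * (y * w') - a * (w * y'))
       (x * w' + w * x' + y * z' - z * y').

Lemma quat_mulA : associative quat_mul.
Proof. by case=> ? ? ? ? [? ? ? ?] [? ? ? ?]; congr Quat; ring. Qed.
Lemma quat_mul1l : left_id (Quat 1 0 0 0) quat_mul.
Proof. by case=> ? ? ? ?; congr Quat; ring. Qed.
Lemma quat_mul1r : right_id (Quat 1 0 0 0) quat_mul.
Proof. by case=> ? ? ? ?; congr Quat; ring. Qed.
Lemma quat_mulDl : left_distributive quat_mul +%R.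
Proof. by case=> ? ? ? ? [? ? ? ?] [? ? ? ?]; congr Quat => /=; ring. Qed.
Lemma quat_mulDr : right_distributive quat_mul +%R.
Proof. by case=> ? ? ? ? [? ? ? ?] [? ? ? ?]; congr Quat => /=; ring. Qed.
Lemma quat_1neq0 : Quat 1 0 0 0 != 0 :> H.
Proof. by apply/eqP => -[/eqP]; rewrite oner_eq0. Qed.
HB.instance Definition _ := GRing.Zmodule_isNzRing.Build H
  quat_mulA quat_mul1l quat_mul1r quat_mulDl quat_mulDr quat_1neq0.

Definition quat_scale (c : F) q : H :=
  Quat (c * qre q) (c * qi q) (c * qj q) (c * qij q).

Lemma quat_scaleA c e q : quat_scale c (quat_scale e q) = quat_scale (c * e) q.
Proof. by congr Quat => /=; ring. Qed.
Lemma quat_scale1 : left_id 1 quat_scale.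
Proof. by case=> ? ? ? ?; congr Quat => /=; ring. Qed.
Lemma quat_scaleDr : right_distributive quat_scale +%R.
Proof. by move=> c p q; congr Quat => /=; ring. Qed.
Lemma quat_scaleDl q : {morph quat_scale^~ q : c e / c + e}.
Proof. by move=> c e; congr Quat => /=; ring. Qed.
HB.instance Definition _ := GRing.Zmodule_isLmodule.Build F H
  quat_scaleA quat_scale1 quat_scaleDr quat_scaleDl.

Lemma quat_scaleAl (c : F) p q : c *: (p * q) = (c *: p) * q.
Proof. by case: p q => ? ? ? ? [? ? ? ?]; congr Quat => /=; ring. Qed.
HB.instance Definition _ := GRing.Lmodule_isLalgebra.Build F H quat_scaleAl.
Lemma quat_scaleAr (c : F) p q : c *: (p * q) = p * (c *: q).
Proof. by case: p q => ? ? ? ? [? ? ? ?]; congr Quat => /=; ring. Qed.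
HB.instance Definition _ := GRing.Lalgebra_isAlgebra.Build F H quat_scaleAr.

Definition quat_i : H := Quat 0 1 0 0.
Definition quat_j : H := Quat 0 0 1 0.

Lemma quat_ii : quat_i ^+ 2 = a%:A.
Proof. by congr Quat => /=; ring. Qed.
Lemma quat_jj : quat_j ^+ 2 = b%:A.
Proof. by congr Quat => /=; ring. Qed.
Lemma quat_ji : quat_j * quat_i = - (quat_i * quat_j).
Proof. by congr Quat => /=; ring. Qed.
Lemma quatE (x y z w : F) :
  Quat x y z w =
  x%:A + y *: quat_i + z *: quat_j + w *: (quat_i * quat_j) :> H.
Proof. by congr Quat => /=; ring. Qed.

Definition quat_norm q : F :=
  (qre q ^+ 2 - a * qi q ^+ 2) - b * (qj q ^+ 2 - a * qij q ^+ 2).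

Definition quat_conj q : H := Quat (qre q) (- qi q) (- qj q) (- qij q).

Lemma quat_normE q : (quat_norm q)%:A = q * quat_conj q.
Proof. by case: q => x y z w; congr Quat; rewrite /quat_norm /=; ring. Qed.

End QuaternionAlgebra.

(* Finite families are functions out of 'I_m; a subfamily is given by a set of
   indices, so repeated values are kept apart. *)
Definition subfamily (T : Type) (n : nat) (f : 'I_n -> T) (S : {set 'I_n}) :
  'I_#|S| -> T := fun k => f (enum_val k).
Arguments subfamily {T n} f S _.

Definition quaternionically_nested (F : fieldType) (d : F) (m : nat)
    (f : 'I_m -> F) : Prop :=
  exists s : 'S_m, forall i : 'I_m,
    exists q : quat d (- \prod_(k < m | (k < i)%N) f (s k)),
      quat_norm q = f (s i).

Section QuadraticExtension.
Variables (F : fieldType) (K : splittingFieldType F) (c : gal_of {:K}).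

(* For K / F quadratic with nontrivial automorphism c, this is the norm of K / F,
   viewed in K; elements x of F are embedded as x%:A. *)
Definition quad_norm (z : K) : K := c z * z.

Definition norm_closed (m : nat) (f : 'I_m -> F) : Prop :=
  exists z : K, quad_norm z = (\prod_(i < m) f i)%:A.

Definition propertyQ (d : F) (n : nat) (f : 'I_n -> F) : Prop :=
  forall S : {set 'I_n}, norm_closed (subfamily f S) ->
    quaternionically_nested d (subfamily f S).

Definition conj_trmx (m n : nat) (X : 'M[K]_(m, n)) : 'M[K]_(n, m) :=
  (map_mx c X)^T.

End QuadraticExtension.

(* Main.v *)
(* Write N for the norm of K / F. If e = N(x) + N(y) P, then the hermitian form
   <1, P> represents e, so <P, 1> is isometric to <e, P e>. Starting from
   P = 1 and applying this to the successive members of the family, reordered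
   so as to be quaternionically nested, turns <1, ..., 1> into
   <d_1, ..., d_(n-1), P> with P = d_1 ... d_(n-1). As the whole family is norm
   closed, P and d_n differ by a norm. *)

Require Import Defs.
From HB Require Import structures.
From mathcomp Require Import all_boot all_order all_fingroup all_algebra all_field.
From mathcomp Require Import ring.

Set Implicit Arguments.
Unset Strict Implicit.
Unset Printing Implicit Defensive.

Import GRing.Theory.
Local Open Scope ring_scope.

Section HermitianDiagonalization.
Variables (K : fieldType) (conj : {rmorphism K -> K}).
Hypothesis conjK : involutive conj.

Local Notation N z := (conj z * z).
Local Notation adj X := (map_mx conj X)^T.

(** Invertibility of [X] is left out of the relation; in the theorem it is recovered from that of
    the diagonal target. *)
Definition herm_isometric (n : nat) (A B : 'M[K]_n) : Prop :=
  exists X : 'M[K]_n, adj X *m A *m X = B.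

Lemma herm_isometric_trans (n : nat) (A B C : 'M[K]_n) :
  herm_isometric A B -> herm_isometric B C -> herm_isometric A C.
Proof.
move=> [X <-] [Y <-]; exists (X *m Y).
by rewrite map_mxM trmx_mul !mulmxA.
Qed.

Lemma herm_isometric_block (m n : nat) (A B : 'M[K]_m) (A' B' : 'M[K]_n) :
  herm_isometric A B -> herm_isometric A' B' ->
  herm_isometric (block_mx A 0 0 A') (block_mx B 0 0 B').
Proof.
move=> [X <-] [Y <-]; exists (block_mx X 0 0 Y).
rewrite map_block_mx tr_block_mx !mulmx_block.
by rewrite !raddf0 !(mulmx0, mul0mx, addr0, add0r).
Qed.

Lemma herm_isometric_refl (n : nat) (A : 'M[K]_n) : herm_isometric A A.
Proof. by exists 1%:M; rewrite map_mx1 trmx1 mul1mx mulmx1. Qed.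

Lemma herm_isometric_pair (P x y : K) (e := N x + N y * P) : conj P = P ->
  herm_isometric (block_mx P%:M 0 0 1%:M : 'M[K]_(1 + 1))
                 (block_mx e%:M 0 0 (P * e)%:M).
Proof.
(* The first column [(y, x)] is a vector on which the form <P, 1> takes the value [e]; the second,
   [(conj x, - P * conj y)], is orthogonal to it and has value [P * e]. *)
move=> cP; exists (block_mx y%:M (conj x)%:M x%:M (- (P * conj y))%:M).
rewrite map_block_mx tr_block_mx !map_scalar_mx !tr_scalar_mx !mulmx_block.
rewrite !(mulmx0, mul0mx, mulmx1, addr0, add0r) -!scalar_mxM.
rewrite -!(raddfD (@scalar_mx K 1)) rmorphN !(rmorphM conj) /= !conjK cP.
rewrite -(raddf0 (@scalar_mx K 1)).
by congr block_mx; congr _%:M; rewrite /e; ring.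
Qed.

(** The form <P, 1, ..., 1>; in the induction [P] is the product of the entries already split
    off. *)
Definition head_mx (n : nat) (P : K) : 'M[K]_n.+1 :=
  block_mx P%:M 0 0 1%:M : 'M[K]_(1 + n).

Lemma head_mx_isometric_cons (n : nat) (P x y : K) (e := N x + N y * P) :
  conj P = P ->
  herm_isometric (head_mx n.+1 P)
                 (block_mx e%:M 0 0 (head_mx n (P * e)) : 'M[K]_(1 + n.+1)).
Proof.
move=> cP.
(* Both sides are bracketed as 2 + n, so that only the leading binary form changes. *)
have regroup (a b : K) :
    block_mx (block_mx a%:M 0 0 b%:M : 'M[K]_(1 + 1)) 0 0 (1%:M : 'M[K]_n) =
    block_mx a%:M 0 0 (head_mx n b) :> 'M[K]_(1 + n.+1).
  have := @block_mxA K 1 1 n 1 1 n a%:M 0 0 0 b%:M 0 0 0 1%:M.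
  by rewrite /= !row_mx0 !col_mx0 castmx_id => ->.
have -> : head_mx n.+1 P = block_mx P%:M 0 0 (head_mx n 1) :> 'M_(1 + n.+1).
  by rewrite /head_mx -scalar_mx_block.
rewrite -!regroup; apply: (@herm_isometric_block 2 n).
- exact: herm_isometric_pair.
- exact: herm_isometric_refl.
Qed.

(** Induction on [n] for all [P] at once: splitting off the first entry replaces [P] by
    [P * f ord0], and the factor [P] in the nesting condition keeps track of the entries already
    removed. *)
Lemma nested_diag_isometric (n : nat) (P : K) (f : 'I_n.+1 -> K) :
    conj P = P -> P != 0 ->
    (forall i, conj (f i) = f i) -> (forall i, f i != 0) ->
    (forall i : 'I_n.+1, exists x y,
       N x + N y * (P * \prod_(k < n.+1 | (k < i)%N) f k) = f i) ->
    (exists z, N z = P * \prod_i f i) ->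
  herm_isometric (head_mx n P) (diag_mx (\row_i f i)).
Proof.
elim: n P f => [|n IH] P f cP P0 cf f0 nested [z Nz].
  (* Since [conj] fixes [P] and N(z) = P f(0), one has N(z / P) P = f(0). *)
  exists (z / P)%:M; rewrite map_scalar_mx tr_scalar_mx.
  apply/matrixP => i j; rewrite /head_mx !mxE big_ord1 !mxE big_ord1 !mxE.
  rewrite !ord1 !split1 unlift_none /= !mxE /= !split1 unlift_none /= !mxE.
  rewrite !eqxx !mulr1n rmorphM fmorphV /= cP.
  rewrite big_ord1 in Nz.
  by rewrite -[f 0](mulKf P0) -Nz; field.
have [x [y fE]] := nested ord0.
rewrite big_pred0_eq mulr1 in fE.
have := head_mx_isometric_cons n x y cP; rewrite fE => /herm_isometric_trans.
apply; pose g i := f (lift ord0 i).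
have -> : diag_mx (\row_i f i) =
    block_mx (f ord0)%:M 0 0 (diag_mx (\row_i g i)) :> 'M_(1 + n.+1).
  have -> : \row_i f i = row_mx (f ord0)%:M (\row_i g i) :> 'rV_(1 + n.+1).
    apply/rowP => i; rewrite !mxE split1.
    by case: unliftP => [j|] -> /=; rewrite !mxE.
  rewrite [LHS](@diag_mx_row _ n.+1 1); congr block_mx; apply/matrixP => i j.
  by rewrite !mxE !ord1.
apply: (@herm_isometric_block 1 n.+1); first exact: herm_isometric_refl.
apply: IH => [||i|i|i|]; rewrite ?rmorphM ?cP ?cf ?mulf_neq0 ?f0 //.
  rewrite /g; have [u [v <-]] := nested (lift ord0 i); exists u, v.
  (* The index 0 lies below every [lift ord0 i], so [f ord0] can be moved from the prefix product
     into the new [P]. *)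
  by rewrite [in RHS]big_mkcond big_ord_recl -[in RHS]big_mkcond /= !mulrA.
by exists z; rewrite Nz big_ord_recl mulrA.
Qed.

Lemma nested_diag_factor (n : nat) (f : 'I_n -> K) :
    (forall i, conj (f i) = f i) -> (forall i, f i != 0) ->
    (forall i : 'I_n, exists x y,
       N x + N y * \prod_(k < n | (k < i)%N) f k = f i) ->
    (exists z, N z = \prod_i f i) ->
  exists X : 'M[K]_n, adj X *m X = diag_mx (\row_i f i).
Proof.
case: n f => [|n] f cf f0 nested [z Nz].
  by exists 0; apply/matrixP => -[].
suff : herm_isometric (head_mx n 1) (diag_mx (\row_i f i)).
  by rewrite /head_mx -scalar_mx_block => -[X]; rewrite mulmx1; exists X.
apply: nested_diag_isometric; rewrite ?rmorph1 ?oner_eq0 //.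
- by move=> i; have [x [y <-]] := nested i; exists x, y; rewrite mul1r.
- by exists z; rewrite mul1r.
Qed.

(** Rows and columns are permuted simultaneously. Two sizes are allowed because a subfamily is
    indexed by the cardinal of its index set, equal to [n] for the full set but not convertible to
    it. *)
Lemma diag_factor_reindex (m n : nat) (h : 'I_m -> 'I_n) (f : 'I_n -> K) :
    bijective h ->
    (exists X : 'M[K]_m, adj X *m X = diag_mx (\row_i f (h i))) ->
  exists X : 'M[K]_n, adj X *m X = diag_mx (\row_i f i).
Proof.
move=> [g hK gK] [X XE]; exists (mxsub g g X); apply/matrixP => i j.
have := congr1 (fun A : 'M_m => A (g i) (g j)) XE.
rewrite !mxE gK (can_eq gK) => <-.
rewrite (reindex g); last by exists h => k _.
by apply: eq_bigr => k _; rewrite !mxE.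
Qed.

End HermitianDiagonalization.

Section QuadraticConjugation.
Variables (F : fieldType) (K : splittingFieldType F) (c : gal_of {:K}).

Lemma gal_scalar (a : F) : c a%:A = a%:A.
Proof. exact: rmorph_alg. Qed.

(** The fixed field of [c] contains [F] and the generator [a], hence is all of [K]. *)
Lemma gal_fix_generator (a : K) :
  <<1; a>>%VS = {:K}%VS -> c a = a -> c = 1%g.
Proof.
move=> gen ca; apply/eqP/gal_eqP => z _; rewrite gal_id.
have /subvP/(_ z (memvf z)) : ({:K} <= fixedField [set c])%VS.
  rewrite -[X in (X <= _)%VS]gen; apply/FadjoinP; split; first exact: sub1v.
  by apply/fixedFieldP => [|s /set1P->]; rewrite ?memvf.
by case/mem_fixedFieldP => _; apply; rewrite inE.
Qed.

End QuadraticConjugation.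

Section QuadraticNorm.
Variables (F : fieldType) (d : F) (K : splittingFieldType F) (sqrtd : K).
Hypothesis sqrtdE : sqrtd ^+ 2 = d%:A.
Hypothesis K_gen : <<1; sqrtd>>%VS = {:K}%VS.
Variable c : gal_of {:K}.
Hypothesis c_neq1 : c != 1%g.

Lemma gal_sqrt : c sqrtd = - sqrtd.
Proof.
have /eqP : c sqrtd ^+ 2 = sqrtd ^+ 2.
  by rewrite -rmorphXn sqrtdE; exact: gal_scalar.
rewrite eqf_sqr => /orP[]/eqP // c_fix.
by case/eqP: c_neq1; apply: gal_fix_generator K_gen c_fix.
Qed.

Lemma gal_involutive : involutive c.
Proof.
have c2 : (c * c)%g = 1%g.
  apply: (gal_fix_generator K_gen).
  by rewrite galM ?memvf // gal_sqrt rmorphN /= gal_sqrt opprK.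
by move=> z; rewrite -galM ?memvf // c2 gal_id.
Qed.

Lemma quad_normE (x y : F) :
  quad_norm c (x%:A + y *: sqrtd) = (x ^+ 2 - d * y ^+ 2)%:A.
Proof.
rewrite /quad_norm -[y *: _]mulr_algl rmorphD rmorphM /= !gal_scalar gal_sqrt.
rewrite scalerBl -[(d * _)%:A]scalerA -[d *: _]mulr_algl -sqrtdE.
rewrite -!in_algE !rmorphXn /=; ring.
Qed.

(** Grouping the coordinates of [q] as (1, i) and (j, ij) gives two elements of [K], and the norm
    form of [q] becomes the hermitian form <1, P> evaluated at them. *)
Lemma quat_norm_sum (P : F) (q : quat d (- P)) : exists x y : K,
  quad_norm c x + quad_norm c y * P%:A = (quat_norm q)%:A.
Proof.
exists ((qre q)%:A + qi q *: sqrtd), ((qj q)%:A + qij q *: sqrtd).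
rewrite !quad_normE -!in_algE -rmorphM -rmorphD /quat_norm /=.
by congr _%:A; ring.
Qed.

End QuadraticNorm.

Theorem theorem4p2 (F : fieldType) (charF0 : [pchar F] =i pred0)
    (d : F) (d_neq0 : d != 0) (d_nsq : forall x : F, x ^+ 2 != d)
    (K : splittingFieldType F) (sqrtd : K) (sqrtdE : sqrtd ^+ 2 = d%:A)
    (K_gen : <<1; sqrtd>>%VS = {:K}%VS)
    (c : gal_of {:K}) (c_gal : c \in 'Gal({:K} / 1)%g) (c_neq1 : c != 1%g)
    (n : nat) (n_gt0 : (0 < n)%N) (f : 'I_n -> F)
    (D_GL : diag_mx (\row_(i < n) f i) \in unitmx)
    (f_closed : norm_closed c f) (f_Q : propertyQ c d f) :
  exists X : 'M[K]_n,
    X \in unitmx /\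
    conj_trmx c X *m X = map_mx (in_alg K) (diag_mx (\row_(i < n) f i)).
Proof.
have f0 i : f i != 0.
  move: D_GL; rewrite unitmxE det_diag unitfE => /prodf_neq0/(_ i isT).
  by rewrite mxE.
have rowE : map_mx (in_alg K) (\row_i f i) = \row_i (f i)%:A.
  by apply/rowP => i; rewrite !mxE.
suff [X XE] : exists X : 'M[K]_n,
    (map_mx c X)^T *m X = diag_mx (\row_i (f i)%:A).
  exists X; split; last by rewrite map_diag_mx rowE.
  move: D_GL; rewrite -(map_unitmx (in_alg K)) map_diag_mx rowE -XE.
  by rewrite unitmx_mul => /andP[].
have enum_bij : bijective (enum_val : 'I_#|[set: 'I_n]| -> 'I_n).
  apply: inj_card_bij; first exact: enum_val_inj.
  by rewrite cardsT !card_ord.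
have prodE (s : 'S_#|[set: 'I_n]|) :
    \prod_i f (enum_val (s i)) = \prod_i f i.
  by rewrite [RHS](reindex _ (onW_bij _ (bij_comp enum_bij (injF_bij (@perm_inj _ s))))).
have [z Nz] := f_closed.
(* Property (Q) is applied to the whole family, viewed as the subfamily over the full index set;
   this yields the nesting order [s]. *)
have [|s nested] := f_Q setT.
  exists z; rewrite Nz -(prodE 1%g); congr _%:A.
  by apply: eq_bigr => i _; rewrite perm1.
apply: (diag_factor_reindex (bij_comp enum_bij (injF_bij (@perm_inj _ s)))).
apply: nested_diag_factor => [|i|i|i|] /=.
- by move=> u; exact: (gal_involutive sqrtdE K_gen c_neq1 u).
- exact: gal_scalar.
- by rewrite scaler_eq0 oner_eq0 orbF.
- have [q] := nested i; rewrite /subfamily => <-.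
  have [x [y <-]] := quat_norm_sum sqrtdE K_gen c_neq1 q.
  by exists x, y; rewrite -in_algE rmorph_prod.
- by exists z; rewrite [LHS]Nz -(prodE s) -in_algE rmorph_prod.
Qed.
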